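(* Let $I$ be a nonzero proper ideal of $R$. Then: (1) $b(I)\ge r\,l_R(I^{**}/I)\ge 0$. (2) $b(I)=0$ if and only if all of the following hold: $I=I^{**}$; $r_h=r$ for every integer $h\ge1$ with $h\notin V^I$; and $\displaystyle\sum_{h\in V^I,\ h\le n_I} r_h=l_R\big((R:\gamma_I)/I^*\big)$.
   Context: Setting: $(R,\mathfrak m)$ is a one-dimensional Noetherian local domain with infinite residue field $k$ and fraction field $K$. Its integral closure $\overline R$ in $K$ is a finite $R$-module and a discrete valuation ring with uniformizer $t$ (analytically irreducible), and $R$ is residually rational: the natural map $k\to\overline R/t\overline R$ is an isomorphism. $v:K\to\mathbb Z\cup\{\infty\}$ is the valuation of $\overline R$ with $v(t)=1$; for a subset $J\subseteq K$, $v(J)=\{v(a): 0\ne a\in J\}$. $l_R$ denotes length of $R$-modules. For fractional ideals, $I:J=\{x\in K: xJ\subseteq I\}$, $I^*=R:I$, $I^{**}=(I^* )^*$. Put $\gamma=R:\overline R=t^c\overline R$ with $c=l_R(\overline R/\gamma)$, $\delta=l_R(\overline R/R)$, $n=c-\delta=l_R(R/\gamma)$, $r=l_R((R:\mathfrak m)/R)$. Type sequence: let $s_0=0<s_1<\dots<s_n=c<s_{n+1}=c+1<\dots$ be the elements of $v(R)$, $R_i=\{a\in R: v(a)\ge s_i\}$, and for $i\ge1$ let $r_i=l_R\big((R:R_i)/(R:R_{i-1})\big)$. One has $r_1=r$, and $r_i=1$ for $i>n$. For a nonzero proper ideal $I$ of $R$: $\gamma_I=t^{c_I}\overline R$ is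 the largest $\overline R$-ideal contained in $I$; $n_I=l_R(R/\gamma_I)=c_I-\delta$; $V^I=\{h+1: h\ge0,\ s_h\in v(I^{**})\}$; $b(I)=r\,l_R(R/I)-l_R(I^*/R)$. *)

(* Defs.v *)
From HB Require Import structures.
From mathcomp Require Import all_boot all_order all_algebra.
From mathcomp Require Import boolp classical_sets functions cardinality.
From mathcomp Require Import constructive_ereal.
Set Implicit Arguments.
Unset Strict Implicit.
Unset Printing Implicit Defensive.
Import Order.TTheory GRing.Theory Num.Theory.
Local Open Scope classical_set_scope.
Local Open Scope ring_scope.

(* The domain R is represented by its image in its fraction field K: rings,
   ideals and fractional ideals are all subsets of K. *)

Section Chains.
Variable T : Type.
Implicit Types (P : set (set T)) (n : nat).

Definition strict_chain P n :=
  exists C : nat -> set T,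
    (forall i, (i <= n)%N -> P (C i)) /\
    (forall i, (i < n)%N -> C i `<` C i.+1).

Definition max_chain_length P n :=
  strict_chain P n /\ forall m, strict_chain P m -> (m <= n)%N.

Lemma max_chain_length_uniq P n m :
  max_chain_length P n -> max_chain_length P m -> n = m.
Proof.
by move=> [cn maxn] [cm maxm]; apply/eqP; rewrite eqn_leq maxn ?maxm.
Qed.

End Chains.

Section Rings.
Variable K : fieldType.
Implicit Types (R A B M I J m : set K) (x y z : K).

Definition has_fraction_field R :=
  forall x, exists a b, [/\ R a, R b, b != 0 & x = a / b].

Definition submodule R M :=
  [/\ M 0, (forall x y, M x -> M y -> M (x + y)) &
      forall a x, R a -> M x -> M (a * x)].

Definition ideal R I := submodule R I /\ I `<=` R.

Definition fin_gen R M :=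
  exists (n : nat) (e : 'I_n -> K),
    M = [set x | exists2 a : 'I_n -> K,
           forall i, R (a i) & x = \sum_(i < n) a i * e i].

Definition noetherian R := forall I, ideal R I -> fin_gen R I.

Definition prime_ideal R P :=
  [/\ ideal R P, P <> R &
      forall x y, R x -> R y -> P (x * y) -> P x \/ P y].

Definition maximal_ideal R m :=
  [/\ ideal R m, m <> R &
      forall J, ideal R J -> m `<=` J -> J <> R -> J = m].

Definition local_ring R m :=
  maximal_ideal R m /\ forall m', maximal_ideal R m' -> m' = m.

Definition krull_dim R d := max_chain_length [set P | prime_ideal R P] d.

(* The underlying set of the quotient A / B. *)
Definition cosets A B : set (set K) :=
  [set [set y | A y /\ B (y - x)] | x in A].

(* The natural map A / M -> B / N is well defined, injective and surjective. *)
Definition natural_iso A M B N :=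
  [/\ A `<=` B, (forall x, A x -> (M x <-> N x)) &
      forall y, B y -> exists2 x, A x & N (y - x)].

Definition integral_closure R : set K :=
  [set x | exists2 p : {poly K}, p \is monic & (forall i, R p`_i) /\ root p x].

(* [length R A B] is the length of the R-module A / B, for R-submodules
   B `<=` A of K: submodules of A / B are the submodules of K between B and A.
   The value is 0 when the length is infinite. *)
Definition length R A B : nat :=
  xget 0%N [set n | max_chain_length
    [set M | [/\ submodule R M, B `<=` M & M `<=` A]] n].

Lemma lengthE R A B n :
  max_chain_length [set M | [/\ submodule R M, B `<=` M & M `<=` A]] n ->
  length R A B = n.
Proof.
move=> Hn; apply: xget_subset1 => // a b; exact: max_chain_length_uniq.
Qed.

Definition colon I J : set K := [set x | forall y, J y -> I (x * y)].

Definition dual R I := colon R I.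

(* The union of all the submodules of K over the integral closure of R that are
   contained in I; by [gamma_largest] it is the largest one. *)
Definition gamma R I : set K :=
  \bigcup_(J in [set J | submodule (integral_closure R) J /\ J `<=` I]) J.

Definition scale x A : set K := [set x * y | y in A].

(* Valuations with values in Z together with +oo, whence the exclusion of -oo. *)
Definition is_valuation (v : K -> \bar int) :=
  [/\ forall x, v x = +oo%E <-> x = 0,
      forall x, v x <> -oo%E,
      forall x y, v (x * y) = (v x + v y)%E &
      forall x y, (Order.min (v x) (v y) <= v (x + y)%R)%E].

Definition valuation_ring (v : K -> \bar int) : set K := [set x | (0 <= v x)%E].

Definition values (v : K -> \bar int) J : set int :=
  [set i | exists x, [/\ J x, x != 0 & v x = i%:E]].

Definition increasing_enumeration (s : nat -> int) (S : set int) :=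
  {homo s : i j / (i < j)%N >-> i < j} /\ range s = S.

Section TypeSequence.
Variables (R : set K) (v : K -> \bar int) (s : nat -> int).

Definition trunc (i : nat) : set K := [set a | R a /\ ((s i)%:E <= v a)%E].

(* Meaningful for 1 <= i only. *)
Definition type_seq (i : nat) : nat :=
  length R (dual R (trunc i)) (dual R (trunc i.-1)).

Definition V_set I : set nat :=
  [set h.+1 | h in [set h | values v (dual R (dual R I)) (s h)]].

End TypeSequence.

Definition cm_type R m : nat := length R (colon R m) R.

Definition b_inv R m I : int :=
  (cm_type R m)%:Z * (length R R I)%:Z - (length R (dual R I) R)%:Z.

Lemma gamma_largest R I J : submodule R I ->
    submodule (integral_closure R) J -> J `<=` I ->
  submodule (integral_closure R) (gamma R I) /\
  (gamma R I `<=` I /\ J `<=` gamma R I).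
Proof.
move=> [I0 ID _] Jmod JI; split; last first.
  by split=> [x [L [_ LI] /LI]|x Jx] //; exists J.
have [J0 _ _] := Jmod; split; first by exists J.
- move=> x y [L [[L0 LD LM] LI] Lx] [N [[N0 ND NM] NI] Ny].
  exists [set z | exists2 a, L a & exists2 b, N b & z = a + b]; last first.
    by exists x => //; exists y.
  split; last by move=> _ [a La [b Nb ->]]; apply: ID; [exact: LI|exact: NI].
  split; first by exists 0 => //; exists 0; rewrite ?addr0.
  + move=> _ _ [a La [b Nb ->]] [a' La' [b' Nb' ->]].
    by exists (a + a'); [exact: LD|exists (b + b'); [exact: ND|rewrite addrACA]].
  + move=> c _ Rc [a La [b Nb ->]].
    by exists (c * a); [exact: LM|exists (c * b); [exact: NM|rewrite mulrDr]].
- move=> a x Ra [L [[L0 LD LM] LI] Lx]; exists L; last exact: LM.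
  by split.
Qed.

End Rings.

(* Main.v *)
Require Import Defs.
From HB Require Import structures.
From mathcomp Require Import all_boot all_order all_algebra.
From mathcomp Require Import boolp classical_sets functions cardinality.
From mathcomp Require Import constructive_ereal.
From mathcomp Require Import zify ring.
Import Order.TTheory GRing.Theory Num.Theory.
Local Open Scope classical_set_scope.
Local Open Scope ring_scope.

(** Write J* for R : J.  Everything follows from two bounds on the colengths of
    duals along the filtration of R by the ideals T h of the elements of value
    at least s_h.

    - Each jump r_h is at most r ([type_seq_le]).  The quotient
      T (h-1) / T h is generated by one element x of value s_(h-1) and is
      killed by the maximal ideal m; multiplication by x therefore embeds
      (T h)* / (T (h-1))* into (R : m) / R.

    - If J is an ideal containing T p, then l(J*/R) is at most the sum of the r_h
      over the h <= p with s_(h-1) not in v(J) ([length_dual_le]).  Filter J*/R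
      by the J* cap (T h)*: the h-th factor embeds in (T h)* / (T (h-1))*, and it
      vanishes when s_(h-1) is the value of an element of J.  The number of
      these h is l(R/J) ([length_ring_count]).

    Take for J the bidual I** of I, which has the same dual as I, and
    for T p the module gamma_I; then p = n_I ([gamma_trunc],
    [length_ring_trunc]).  With W the sum of the r_h over the h <= n_I outside V,
    the two bounds give
      l(I*/R) <= W <= r l(R/I** ) = r l(R/I) - r l(I**/I),
    which is part (1).  As r > 0 ([cm_type_gt0]), b(I) vanishes exactly when
    I = I** and both inequalities are equalities.  Equality on the right
    means r_h = r for all h outside V.  Equality on the left is the last condition
    of part (2), because the r_h with h <= n_I add up to
    l(gamma_I*/R) = l(gamma_I*/I* ) + l(I*/R) ([length_type_seq]).

    The lengths are handled through value sets: since R is residually rational,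
    l(A/B) is the number of elements of v(A) outside v(B), for all fractional
    ideals B inside A ([length_count]).  This makes lengths finite and additive, and
    reduces strict inclusions to comparisons of integers. *)

(** * Balls of a discrete valuation *)

Section Valuation.
Set Implicit Arguments.
Unset Strict Implicit.
Context (K : fieldType) (v : K -> \bar int) (v_val : is_valuation v).
Implicit Types (x y : K) (i j : int).

Definition vball i : set K := [set x | (i%:E <= v x)%E].

Lemma valuation_fin x : x != 0 -> exists i, v x = i%:E.
Proof.
case: v_val => v0 vNoo _ _ x0; case vx: (v x) => [i||]; first by exists i.
- by move/v0: vx x0 => ->; rewrite eqxx.
- by have := vNoo x; rewrite vx.
Qed.

Lemma fin_valuation_neq0 x i : v x = i%:E -> x != 0.
Proof. by case: v_val => v0 _ _ _ vx; apply/eqP => /v0; rewrite vx. Qed.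

Lemma valuationM x y i j : v x = i%:E -> v y = j%:E -> v (x * y) = (i + j)%:E.
Proof. by case: v_val => _ _ vM _; rewrite vM => -> ->. Qed.

Lemma valuation1 : v 1 = 0%:E.
Proof.
have [i vi] := valuation_fin (oner_neq0 K).
by have := valuationM vi vi; rewrite mulr1 vi => -[] ii; congr EFin; lia.
Qed.

Lemma valuationV x i : v x = i%:E -> v x^-1 = (- i)%:E.
Proof.
move=> vx; have x0 := fin_valuation_neq0 vx.
have [j vj] : exists j, v x^-1 = j%:E by apply: valuation_fin; rewrite invr_eq0.
by have := valuationM vx vj; rewrite divff // valuation1 vj => -[] ij; congr EFin; lia.
Qed.

Lemma vball0 i : vball i 0.
Proof. by case: v_val => v0 _ _ _; rewrite /vball /= (v0 0).2 // leey. Qed.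

Lemma vball_le i j : i <= j -> vball j `<=` vball i.
Proof. by move=> ij x; apply: le_trans; rewrite lee_fin. Qed.

Lemma vball_val x i j : v x = i%:E -> vball j x = (j <= i).
Proof. by rewrite /vball /= => ->; rewrite lee_fin. Qed.

Lemma vballD i x y : vball i x -> vball i y -> vball i (x + y).
Proof.
case: v_val => _ _ _ vD ix iy; apply: le_trans (vD _ _).
by rewrite le_min; apply/andP.
Qed.

Lemma vballM i j x y : vball i x -> vball j y -> vball (i + j) (x * y).
Proof.
have [->|x0] := eqVneq x 0; first by rewrite mul0r => _ _; apply: vball0.
have [->|y0] := eqVneq y 0; first by rewrite mulr0 => _ _; apply: vball0.
have [a va] := valuation_fin x0; have [b vb] := valuation_fin y0.
rewrite (vball_val _ va) (vball_val _ vb) (vball_val _ (valuationM va vb)) => ? ?.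
lia.
Qed.

(** The value a of -1 satisfies a + a = v(1) = 0. *)
Lemma vballN i x : vball i x -> vball i (- x).
Proof.
suff N1 : vball 0 (-1) by rewrite -mulN1r -{2}[i]add0r; apply: vballM.
have [j vj] : exists j, v (-1) = j%:E by apply: valuation_fin; rewrite oppr_eq0 oner_neq0.
by have := valuationM vj vj; rewrite mulrNN mulr1 valuation1 (vball_val _ vj) => -[]; lia.
Qed.

Lemma vballB i x y : vball i x -> vball i y -> vball i (x - y).
Proof. by move=> ix iy; apply/vballD/vballN. Qed.

Lemma vball_div i j x y : v x = i%:E -> vball j y -> vball (j - i) (y / x).
Proof. by move=> vx jy; apply: vballM; rewrite // (vball_val _ (valuationV vx)). Qed.

Lemma vball_cases i x : vball i x -> v x = i%:E \/ vball (i + 1) x.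
Proof.
have [->|x0] := eqVneq x 0; first by right; apply: vball0.
have [a va] := valuation_fin x0; rewrite !(vball_val _ va) va => ia.
have [->|?] := eqVneq a i; [by left | right; lia].
Qed.

Lemma valuation_dominant i x y : v x = i%:E -> vball (i + 1) y -> v (x + y) = i%:E.
Proof.
move=> vx iy; have ix: vball i x by rewrite (vball_val _ vx).
have iy': vball i y by apply: vball_le iy; lia.
have [//|i1] := vball_cases (vballD ix iy').
by have := vballB i1 iy; rewrite addrK (vball_val _ vx); lia.
Qed.

End Valuation.

(** * Residually rational rings *)

Section Ring.
Set Implicit Arguments.
Unset Strict Implicit.
Context (K : fieldType) (R m : set K) (t : K) (v : K -> \bar int).
Context (R_subring : subring_closed [in R]).
Context (R_frac : has_fraction_field R).
Context (Rbar_fin : fin_gen R (integral_closure R)).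
Context (v_val : is_valuation v).
Context (Rbar_dvr : integral_closure R = valuation_ring v).
Context (v_t : v t = 1%:E).
Context (R_resrat : natural_iso R m (integral_closure R)
                  (scale t (integral_closure R))).
Implicit Types (A B C M P Q I J : set K) (x y z : K) (N n p : nat).

Local Notation U := (vball v).

Lemma ring1 : R 1.
Proof. by case: R_subring; rewrite in_setE. Qed.

Lemma ringB x y : R x -> R y -> R (x - y).
Proof. by case: R_subring => _ h _ rx ry; have := h x y; rewrite !in_setE; apply. Qed.

Lemma ringM x y : R x -> R y -> R (x * y).
Proof. by case: R_subring => _ _ h rx ry; have := h x y; rewrite !in_setE; apply. Qed.

Lemma ring0 : R 0.
Proof. by rewrite -(subrr 1); apply: ringB; apply: ring1. Qed.

Lemma ringN x : R x -> R (- x).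
Proof. by rewrite -sub0r; apply: ringB; apply: ring0. Qed.

Lemma ringD x y : R x -> R y -> R (x + y).
Proof. by move=> rx ry; rewrite -[y]opprK; apply/ringB/ringN. Qed.

Lemma ring_submodule : submodule R R.
Proof. by split; [exact: ring0|exact: ringD|exact: ringM]. Qed.

Lemma submodN M x : submodule R M -> M x -> M (- x).
Proof. by case=> _ _ MZ Mx; rewrite -mulN1r; apply: MZ => //; apply/ringN/ring1. Qed.

Lemma submodB M x y : submodule R M -> M x -> M y -> M (x - y).
Proof. by move=> sM Mx My; case: (sM) => _ MD _; apply: MD => //; apply: submodN. Qed.

Lemma submodI A B : submodule R A -> submodule R B -> submodule R (A `&` B).
Proof.
case=> A0 AD AZ [B0 BD BZ]; split=> //.
- by move=> x y [? ?] [? ?]; split; [apply: AD|apply: BD].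
- by move=> a x Ra [? ?]; split; [apply: AZ|apply: BZ].
Qed.

Lemma submod_colon A J : submodule R A -> submodule R (colon A J).
Proof.
case=> A0 AD AZ; split.
- by move=> y _; rewrite mul0r.
- by move=> x y Ax Ay z Jz; rewrite mulrDl; apply: AD; [apply: Ax|apply: Ay].
- by move=> a x Ra Ax z Jz; rewrite -mulrA; apply: AZ => //; apply: Ax.
Qed.

Lemma integral_closureE : integral_closure R = U 0.
Proof. by rewrite Rbar_dvr. Qed.

Lemma ring_sub_vball : R `<=` U 0.
Proof. by rewrite -integral_closureE; case: R_resrat. Qed.

Lemma scale_vball : scale t (integral_closure R) = U 1.
Proof.
rewrite integral_closureE; apply/seteqP; split=> [_ [x Ux <-]|x Ux].
  by rewrite -[1]addr0; apply: vballM; rewrite // (vball_val _ v_t).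
have t0 := fin_valuation_neq0 v_val v_t.
exists (x / t); last by rewrite mulrC divfK.
by have := vball_div v_val v_t Ux; rewrite subrr.
Qed.

Lemma maximal_idealE : m `<=` R -> m = R `&` U 1.
Proof.
case: R_resrat => _ h _ mR; apply/seteqP; split=> [x mx|x [Rx]]; last first.
  by rewrite -scale_vball => /h; apply.
by split; [exact: mR|rewrite -scale_vball; apply/h => //; exact: mR].
Qed.

Lemma submod_vball i : submodule R (U i).
Proof.
split; [exact: vball0|exact: vballD|] => a x /ring_sub_vball Ra Ux.
by rewrite -[i]add0r; apply: vballM.
Qed.

(** This is residual rationality in the form used everywhere below: the unit
    leading coefficient of y / x is congruent to an element of R modulo t. *)
Lemma cancel_leading x y i : v x = i%:E -> U i y ->
  exists2 a, R a & U (i + 1) (y - a * x).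
Proof.
move=> vx Uy; have x0 := fin_valuation_neq0 v_val vx.
have U0 : U 0 (y / x) by have := vball_div v_val vx Uy; rewrite subrr.
case: R_resrat => _ _ /(_ (y / x)); rewrite scale_vball integral_closureE.
move=> /(_ U0) [a Ra U1]; exists a => //.
have -> : y - a * x = x * (y / x - a).
  by rewrite mulrBr mulrCA divff // mulr1 mulrC [x * a]mulrC.
by apply: vballM; rewrite // (vball_val _ vx).
Qed.

(** A common denominator of finitely many generators of the integral closure
    multiplies all of it into R. *)
Lemma conductor_exists : exists c, U c `<=` R.
Proof.
case: Rbar_fin => n [e Re].
have [b bP] : exists b : 'I_n -> K, forall i, [/\ R (b i), b i != 0 & R (b i * e i)].
  have h i : exists b, [/\ R b, b != 0 & R (b * e i)].
    have [x [y [Rx Ry y0 ->]]] := R_frac (e i).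
    by exists y; split=> //; rewrite mulrCA divff // mulr1.
  by have [b bP] := choice h; exists b.
set d := \prod_i b i.
have d0 : d != 0 by apply/prodf_neq0 => i _; case: (bP i).
have Rd i : R (d * e i).
  rewrite /d (bigD1 i) //= mulrAC; apply: ringM; first by case: (bP i).
  by elim/big_ind: _ => [|x y|j _]; [exact: ring1|exact: ringM|case: (bP j)].
have [c vd] := valuation_fin v_val d0.
exists c => x Ux.
have : integral_closure R (x / d).
  by rewrite integral_closureE; have := vball_div v_val vd Ux; rewrite subrr.
rewrite Re => -[a Ra xd].
have -> : x = \sum_i a i * (d * e i).
  rewrite -[LHS](divfK d0) xd mulr_suml; apply: eq_bigr => i _; ring.
elim/big_ind: _ => [|y z|j _]; [exact: ring0|exact: ringD|exact: ringM].
Qed.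

(** * Fractional ideals *)

(** Being caught between two balls is the form of being a nonzero fractional
    ideal that bounds the values of M.  A single N serves for both balls, so that
    finitely many modules can be given the same frame. *)
Definition framed N M :=
  [/\ submodule R M, U N%:Z `<=` M & M `<=` U (- N%:Z)].

Definition fractional M := exists N, framed N M.

Lemma framed_le N N' M : (N <= N')%N -> framed N M -> framed N' M.
Proof.
move=> le [sM UM MU]; split=> //.
  by apply: subset_trans UM; apply: vball_le; lia.
by apply: subset_trans MU _; apply: vball_le; lia.
Qed.

Lemma fractional_squeeze A M B : submodule R M -> fractional A -> fractional B ->
  A `<=` M -> M `<=` B -> fractional M.
Proof.
move=> sM [N fA] [N' fB] AM MB; exists (maxn N N').
have [_ UA _] := framed_le (leq_maxl N N') fA.
have [_ _ BU] := framed_le (leq_maxr N N') fB.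
by split=> //; [exact: subset_trans AM|exact: subset_trans BU].
Qed.

Lemma fractionalI A B : fractional A -> fractional B -> fractional (A `&` B).
Proof.
move=> [N fA] [N' fB]; exists (maxn N N').
have [sA UA AU] := framed_le (leq_maxl N N') fA.
have [sB UB BU] := framed_le (leq_maxr N N') fB.
split; first exact: submodI.
  by move=> x Ux; split; [exact: UA|exact: UB].
by move=> x [/AU].
Qed.

Lemma fractional_vball i : fractional (U i).
Proof.
by exists (absz i); split; [exact: submod_vball|apply: vball_le; lia|apply: vball_le; lia].
Qed.

Lemma fractional_ring : fractional R.
Proof.
have [c cR] := conductor_exists.
exact: (fractional_squeeze ring_submodule (fractional_vball c)
                           (fractional_vball 0) cR ring_sub_vball).
Qed.

Lemma fractional_ideal I : ideal R I -> I <> [set 0] -> fractional I.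
Proof.
move=> [sI IR] I0.
have [x [Ix x0]] : exists x, I x /\ x != 0.
  apply: contrapT => /forallNP h; apply: I0; apply/seteqP.
  split=> x; last by move=> ->; case: sI.
  by move=> Ix /=; apply/eqP; apply: contrapT => /negP x0; apply: (h x).
have [i vx] := valuation_fin v_val x0; have [c cR] := conductor_exists.
apply: (fractional_squeeze sI (fractional_vball (c + i)) fractional_ring _ IR) => y Uy.
rewrite -[y](divfK x0); case: sI => _ _; apply => //; apply: cR.
by have := vball_div v_val vx Uy; rewrite addrK.
Qed.

Lemma valuation_exp i : v (t ^ i) = i%:E.
Proof.
have pos n : v (t ^+ n) = (n%:Z)%:E.
  elim: n => [|n ih]; first by rewrite expr0 valuation1.
  by rewrite exprS (valuationM v_val v_t ih); congr EFin; lia.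
case: i => n; first exact: pos.
by rewrite NegzE -exprnN (valuationV v_val (pos _)).
Qed.

(** Testing x in A* on a power of t that lies in A bounds the value of x from
    below. *)
Lemma fractional_dual A : fractional A -> fractional (dual R A).
Proof.
move=> [N [sA UA AU]]; have [c cR] := conductor_exists.
apply: (fractional_squeeze (submod_colon _ ring_submodule) (fractional_vball (c + N%:Z))
   (fractional_vball (- N%:Z))).
  move=> x Ux y /AU Uy; apply: cR.
  by have := vballM v_val Ux Uy; rewrite addrK.
move=> x Ax; have vt := valuation_exp N%:Z.
have /Ax /ring_sub_vball Ux : A (t ^ N%:Z) by apply: UA; rewrite (vball_val _ vt).
have := vball_div v_val vt Ux.
by rewrite mulfK ?(fin_valuation_neq0 v_val vt) // sub0r.
Qed.

(** * Lengths of quotients and sets of values *)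

Lemma values_sub A B : A `<=` B -> values v A `<=` values v B.
Proof. by move=> AB i [x [Ax x0 vx]]; exists x; split=> //; apply: AB. Qed.

Lemma valuesP A i x : A x -> v x = i%:E -> values v A i.
Proof. by move=> Ax vx; exists x; split=> //; apply: fin_valuation_neq0 vx. Qed.

(** Successive approximation: an element of A is corrected by elements of B of
    the same value until its value is so large that it lies in B.  The induction
    is on the distance of its value to N. *)
Lemma values_le_sub N A B : submodule R A -> submodule R B -> B `<=` A -> U N%:Z `<=` B ->
  values v A `<=` values v B -> A `<=` B.
Proof.
move=> sA sB BA UB vAB.
have [A0 AD AZ] := sA; have [B0 BD BZ] := sB.
have key k x : A x -> U (N%:Z - k%:Z) x -> B x.
  elim: k x => [|k ih] x Ax Ux; first by apply: UB; move: Ux; rewrite subr0.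
  have [vx|Ux'] := vball_cases v_val Ux; last first.
    by apply: ih => //; apply: vball_le Ux'; lia.
  have [|y [By y0 vy]] := vAB (N%:Z - k.+1%:Z); first exact: valuesP vx.
  have [a Ra Ua] := cancel_leading vy Ux.
  rewrite -[x](subrK (a * y)); apply: BD; last exact: BZ.
  apply: ih; first by apply: submodB => //; apply: AZ => //; apply: BA.
  by apply: vball_le Ua; lia.
move=> x Ax; have [->//|x0] := eqVneq x 0.
have [i vx] := valuation_fin v_val x0.
by apply: (key (absz (N%:Z - i))) => //; rewrite (vball_val _ vx); lia.
Qed.

Definition window N : seq int := [seq i%:Z - N%:Z | i <- iota 0 (N + N)].

Lemma mem_window N i : (i \in window N) = (- N%:Z <= i < N%:Z).
Proof.
apply/mapP/idP => [[j]|iN]; first by rewrite mem_iota => ? ->; lia.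
by exists (absz (i + N%:Z)); rewrite ?mem_iota; lia.
Qed.

Lemma window_uniq N : uniq (window N).
Proof. by rewrite map_inj_uniq ?iota_uniq // => i j; lia. Qed.

(** The value set of a module framed by N contains every integer from N on and
    none below - N, so this count determines its size relative to that of any other
    such module. *)
Definition value_count N A := count (fun i => `[< values v A i >]) (window N).

Definition gap A B i := `[< values v A i >] && ~~ `[< values v B i >].

Lemma value_countD N A B : B `<=` A ->
  value_count N A = (value_count N B + count (gap A B) (window N))%N.
Proof.
move=> BA; rewrite /value_count -count_predUI -[LHS]addn0; congr addn.
  apply: eq_count => i /=; rewrite /gap; case: asboolP => hA; case: asboolP => hB //.
  by case: hA; apply: values_sub hB.
rewrite -(count_pred0 (window N)); apply/esym/eq_count => i /=.
by rewrite /gap; case: asboolP; rewrite ?andbF.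
Qed.

Lemma gap_window N A B i : framed N A -> framed N B -> gap A B i -> i \in window N.
Proof.
move=> [_ _ AU] [_ UB _] /andP[/asboolP[x [Ax x0 vx]] /asboolP nB].
rewrite mem_window; have := AU _ Ax; rewrite (vball_val _ vx) => -> /=.
rewrite ltNge; apply/negP => Ni; apply: nB; exists x; split=> //; apply: UB.
by rewrite (vball_val _ vx).
Qed.

Lemma gap_exists N A B : framed N A -> framed N B -> B `<` A -> exists i, gap A B i.
Proof.
move=> [sA _ _] [sB UB _] [BA nAB]; apply: contrapT => /forallNP h; apply: nAB.
apply: (values_le_sub sA sB) UB _ => // i vi; apply: contrapT => nvi; apply: (h i).
by apply/andP; split; apply/asboolP.
Qed.

Lemma value_count_lt N A B : framed N A -> framed N B -> B `<` A ->
  (value_count N B < value_count N A)%N.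
Proof.
move=> fA fB BA; have [i gi] := gap_exists fA fB BA.
rewrite (@value_countD N A B); last by case: BA.
rewrite -addn1 leq_add2l -has_count; apply/hasP; exists i => //.
exact: gap_window gi.
Qed.

(** The gaps lie below N, so the largest one is N - k with k minimal. *)
Lemma max_gap N A B : framed N A -> framed N B -> B `<` A ->
  exists2 i, gap A B i & forall j, gap A B j -> j <= i.
Proof.
move=> fA fB BA; have [i gi] := gap_exists fA fB BA.
have ex : exists k : nat, gap A B (N%:Z - k%:Z).
  exists (absz (N%:Z - i)); have := gap_window fA fB gi; rewrite mem_window => ?.
  by suff -> : N%:Z - `|N%:Z - i|%N%:Z = i by []; lia.
case: (ex_minnP ex) => k gk mink; exists (N%:Z - k%:Z) => // j gj.
have := gap_window fA fB gj; rewrite mem_window => jN.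
have := mink (absz (N%:Z - j)); suff -> : N%:Z - `|N%:Z - j|%N%:Z = j by move=> /(_ gj); lia.
lia.
Qed.

Definition submod_sum A B : set K := [set z | exists2 x, A x & B (z - x)].

Lemma submod_submod_sum A B : submodule R A -> submodule R B -> submodule R (submod_sum A B).
Proof.
move=> [A0 AD AZ] [B0 BD BZ]; split; first by exists 0 => //; rewrite subr0.
  move=> x y [a Aa Ba] [b Ab Bb]; exists (a + b); first exact: AD.
  by rewrite opprD addrACA; apply: BD.
move=> a x Ra [b Ab Bb]; exists (a * b); first exact: AZ.
by rewrite -mulrBr; apply: BZ.
Qed.

Lemma submod_sum_l A B : submodule R B -> A `<=` submod_sum A B.
Proof. by move=> [B0 _ _] x Ax; exists x; rewrite // subrr. Qed.

Lemma submod_sum_r A B : submodule R A -> B `<=` submod_sum A B.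
Proof. by move=> [A0 _ _] x Bx; exists 0; rewrite // subr0. Qed.

Lemma submod_sum_sub A B C : submodule R C -> A `<=` C -> B `<=` C -> submod_sum A B `<=` C.
Proof.
move=> [_ CD _] AC BC x [a Aa Ba]; rewrite -[x](subrK a).
by apply: CD; [exact: BC|exact: AC].
Qed.

(** If i is the largest gap, adjoining to B the elements of A of value at least i
    creates no value but i: a sum b + a of value less than i has the value of b,
    and a value greater than i is already one of B. *)
Lemma one_more_value N A B : framed N A -> framed N B -> B `<` A ->
  exists C, [/\ framed N C, B `<` C, C `<=` A & value_count N C = (value_count N B).+1].
Proof.
move=> fA fB BA; have [i gi maxi] := max_gap fA fB BA.
have [sA UA AU] := fA; have [sB UB BU] := fB.
have sAi : submodule R (A `&` U i) by apply: submodI => //; apply: submod_vball.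
pose C := submod_sum B (A `&` U i).
have BC : B `<=` C by apply: submod_sum_l.
have CA : C `<=` A by apply: submod_sum_sub; [exact: sA|case: BA|move=> x []].
have sC : submodule R C by apply: submod_submod_sum.
have fC : framed N C by split; [exact: sC|exact: subset_trans BC|exact: subset_trans AU].
have gC : gap C B =1 pred1 i.
  move=> j; rewrite /= /gap; apply/idP/eqP => [|->].
    move=> gj; have ji : j <= i.
      apply: maxi; move: gj => /andP[/asboolP vj nj]; apply/andP; split=> //.
      by apply/asboolP; apply: values_sub vj.
    apply/eqP; rewrite eq_le ji /= leNgt; apply/negP => lt_ji.
    move: gj => /andP[/asboolP [x [[b Bb [_ Ub]] x0 vx]] /asboolP]; apply.
    apply: (valuesP Bb); have -> : b = x + - (x - b) by ring.
    by apply: (valuation_dominant v_val vx); apply: vballN => //; apply: vball_le Ub; lia.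
  move: gi => /andP[/asboolP [x [Ax x0 vx]] ->]; rewrite andbT; apply/asboolP.
  apply: (valuesP _ vx); apply: submod_sum_r => //; split=> //.
  by rewrite (vball_val _ vx).
have cC : value_count N C = (value_count N B).+1.
  rewrite (value_countD N BC) (eq_count gC) count_uniq_mem ?window_uniq //.
  by rewrite (gap_window fA fB gi) addn1.
exists C; split=> //; split=> // CB.
have CBe : C = B by apply/seteqP.
by move: cC; rewrite CBe; lia.
Qed.

Lemma strict_chain_count N A B : framed N A -> framed N B -> B `<=` A ->
  strict_chain [set M | [/\ submodule R M, B `<=` M & M `<=` A]]
    (value_count N A - value_count N B).
Proof.
move=> fA; move e: (value_count N A - value_count N B)%N => k.
elim: k B e => [|k ih] B e fB BA.
  by exists (fun=> B); split=> // i _; split=> //; case: fB.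
have ltBA : B `<` A.
  split=> // AB; have AeB : A = B by apply/seteqP.
  by move: e; rewrite AeB subnn.
have [C [fC ltBC CA cC]] := one_more_value fA fB ltBA.
have [|c [cP clt]] := ih C _ fC CA; first by lia.
exists (fun i => if i is j.+1 then c j else B); split=> [[|i] ile|[|i] ilt].
- by split=> //; case: fB.
- have [sc Cc cA] := cP i ile; split=> //; apply: subset_trans Cc; by case: ltBC.
- have [sc Cc cA] := cP 0%N isT; case: ltBC => BC nCB; split; first exact: subset_trans Cc.
  by move=> cB; apply: nCB; apply: subset_trans cB.
- exact: clt.
Qed.

(** A chain whose value counts grow by one at each step exists by
    [strict_chain_count]; none is longer, since value counts strictly increase
    along every strict chain. *)
Lemma max_chain_length_count N A B : framed N A -> framed N B -> B `<=` A ->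
  max_chain_length [set M | [/\ submodule R M, B `<=` M & M `<=` A]]
    (value_count N A - value_count N B).
Proof.
move=> fA fB BA; split; first exact: strict_chain_count.
move=> k [c [cP clt]].
have fc i : (i <= k)%N -> framed N (c i).
  move=> /cP[sc Bc cA]; have [_ _ AU] := fA; have [_ UB _] := fB.
  by split=> //; [exact: subset_trans Bc|exact: subset_trans AU].
have le i : (i <= k)%N -> (value_count N B + i <= value_count N (c i))%N.
  elim: i => [|i ih] ik.
    by have [_ Bc _] := cP _ ik; rewrite (value_countD N Bc) addn0 leq_addr.
  rewrite addnS; apply: leq_ltn_trans (ih (ltnW ik)) _.
  by apply: value_count_lt; [exact: fc|exact/fc/ltnW|exact: clt].
have := le k (leqnn k); have [_ _ cA] := cP k (leqnn k).
by rewrite (value_countD N cA); lia.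
Qed.

Lemma length_count N A B : framed N A -> framed N B -> B `<=` A ->
  (length R A B + value_count N B = value_count N A)%N.
Proof.
move=> fA fB BA; rewrite (lengthE (max_chain_length_count fA fB BA)).
by rewrite subnK // (value_countD N BA) leq_addr.
Qed.

Lemma max_chain_length_fractional A B : fractional A -> fractional B -> B `<=` A ->
  max_chain_length [set M | [/\ submodule R M, B `<=` M & M `<=` A]] (length R A B).
Proof.
move=> [N fA] [N' fB] BA.
have h := max_chain_length_count (framed_le (leq_maxl N N') fA)
            (framed_le (leq_maxr N N') fB) BA.
by rewrite (lengthE h).
Qed.

Lemma length_add A B C : fractional A -> fractional B -> fractional C ->
  B `<=` A -> C `<=` B -> length R A C = (length R A B + length R B C)%N.
Proof.
move=> [a fA] [b fB] [c fC] BA CB; pose N := (a + b + c)%N.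
have {}fA : framed N A by apply: framed_le fA; lia.
have {}fB : framed N B by apply: framed_le fB; lia.
have {}fC : framed N C by apply: framed_le fC; lia.
have := length_count fA fB BA; have := length_count fB fC CB.
have := length_count fA fC (subset_trans CB BA); lia.
Qed.

Lemma length_refl A : fractional A -> length R A A = 0%N.
Proof. by move=> fA; have := length_add fA fA fA (@subset_refl _ A) (@subset_refl _ A); lia. Qed.

Lemma length_eq0 A B : fractional A -> fractional B -> B `<=` A ->
  length R A B = 0%N -> A = B.
Proof.
move=> [N fA] [N' fB] BA l0; apply/seteqP; split=> //; apply: contrapT => nAB.
have {}fA := framed_le (leq_maxl N N') fA; have {}fB := framed_le (leq_maxr N N') fB.
by have := length_count fA fB BA; have := value_count_lt fA fB (conj BA nAB); lia.
Qed.

(** The hypotheses say that multiplication by x induces an injective linear map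
    from P / Q to P' / Q'.  The map sending M to x M + Q' carries strict chains of
    submodules between Q and P to strict chains between Q' and P'. *)
Lemma length_le_mul x P Q P' Q' :
  fractional P -> fractional Q -> fractional P' -> fractional Q' ->
  Q `<=` P -> Q' `<=` P' ->
  (forall y, P y -> P' (x * y)) -> (forall y, P y -> Q' (x * y) -> Q y) ->
  (length R P Q <= length R P' Q')%N.
Proof.
move=> fP fQ fP' fQ' QP QP' PP' PQ.
have [[c [cP clt]] _] := max_chain_length_fractional fP fQ QP.
have [_] := max_chain_length_fractional fP' fQ' QP'; apply.
have sP' : submodule R P' by case: fP' => ? [].
have sQ' : submodule R Q' by case: fQ' => ? [].
pose f M := submod_sum [set x * y | y in M] Q'.
have sf M : submodule R M -> submodule R [set x * y | y in M].
  move=> [M0 MD MZ]; split; first by exists 0; rewrite ?mulr0.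
    by move=> _ _ [y My <-] [z Mz <-]; exists (y + z); rewrite ?mulrDr //; apply: MD.
  by move=> a _ Ra [y My <-]; exists (a * y); [exact: MZ|rewrite mulrCA].
exists (fun i => f (c i)); split=> i ik.
  have [sc Qc cPi] := cP i ik; split; first exact/submod_submod_sum/sQ'/sf.
    exact/submod_sum_r/sf.
  by apply: submod_sum_sub => // _ [y cy <-]; apply/PP'/cPi.
have [sc Qc cPi] := cP i (ltnW ik); have [sc' Qc' cPi'] := cP _ ik.
have [cc ncc] := clt _ ik; split.
  by move=> z [_ [y cy <-] Qz]; exists (x * y) => //; exists y => //; apply: cc.
move=> ff; apply: ncc => y cy.
have [_ [z cz <-]] : f (c i) (x * y) by apply/ff/submod_sum_l => //; exists y.
rewrite -mulrBr => Qxyz; rewrite -[y](subrK z); case: (sc) => _ cD _; apply: cD => //.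
apply: Qc; apply: PQ => //; apply: submodB; [by case: fP => ? []|exact: cPi'|exact: cPi].
Qed.


(** * Duals and the Cohen-Macaulay type *)

Local Notation "J ^*" := (dual R J).

Lemma dual_anti A B : A `<=` B -> B^* `<=` A^*.
Proof. by move=> AB x Bx y /AB; apply: Bx. Qed.

Lemma dual_ring : R^* = R.
Proof.
apply/seteqP; split=> [x /(_ 1 ring1)|x Rx y Ry]; first by rewrite mulr1.
exact: ringM.
Qed.

Lemma sub_bidual A : A `<=` A^*^*.
Proof. by move=> x Ax y Ay; rewrite mulrC; apply: Ay. Qed.

Lemma tridual A : A^*^*^* = A^*.
Proof. by apply/seteqP; split; [apply/dual_anti/sub_bidual|exact: sub_bidual]. Qed.

Lemma ring_sub_dual A : A `<=` R -> R `<=` A^*.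
Proof. by move=> /dual_anti; rewrite dual_ring. Qed.

Lemma bidual_sub_ring A : A `<=` R -> A^*^* `<=` R.
Proof. by move=> /ring_sub_dual /dual_anti; rewrite dual_ring. Qed.

Lemma fractional_maximal_ideal : m `<=` R -> fractional m.
Proof.
move=> mR; rewrite (maximal_idealE mR).
exact: fractionalI fractional_ring (fractional_vball 1).
Qed.

(** If R : m were R, then R would contain with each ball the next larger one,
    because m multiplies the larger ball into the smaller one.  Starting from the
    conductor, R would then contain an element of negative value. *)
Lemma cm_type_gt0 : m `<=` R -> (0 < cm_type R m)%N.
Proof.
move=> mR; rewrite lt0n; apply/eqP => r0.
have mm : colon R m = R.
  apply: length_eq0 r0; [exact/fractional_dual/fractional_maximal_ideal|exact: fractional_ring|].
  exact: ring_sub_dual.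
have [c cR] := conductor_exists.
have key k : U (c - k%:Z) `<=` R.
  elim: k => [|k ih] x Ux; first by apply: cR; move: Ux; rewrite subr0.
  rewrite -mm => z mz; apply: ih; move: mz; rewrite (maximal_idealE mR) => -[_ Uz].
  by apply: vball_le (vballM v_val Ux Uz); lia.
have vt := valuation_exp (-1).
have /ring_sub_vball : R (t ^ (-1)).
  by apply: (key (absz (c + 1))); rewrite (vball_val _ vt); lia.
by rewrite (vball_val _ vt).
Qed.

(** * The type sequence *)

Context (s : nat -> int) (s_enum : increasing_enumeration s (values v R)).

Local Notation T := (trunc R v s).

Lemma enum_le i j : (i <= j)%N -> s i <= s j.
Proof.
case: s_enum => s_lt _; rewrite leq_eqVlt => /orP[/eqP->//|/s_lt]; exact: ltW.
Qed.

Lemma enum_ltn i j : s i < s j -> (i < j)%N.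
Proof. by rewrite ltNge => sij; rewrite ltnNge; apply: contra sij; apply: enum_le. Qed.

Lemma enum_value h : exists2 x, R x & v x = (s h)%:E.
Proof.
case: s_enum => _ sR; have : values v R (s h) by rewrite -sR; exists h.
by case=> x [Rx _ vx]; exists x.
Qed.

Lemma value_enum x i : R x -> v x = i%:E -> exists h, s h = i.
Proof.
move=> Rx vx; case: s_enum => _ sR; have := valuesP Rx vx.
by rewrite -sR => -[h _ <-]; exists h.
Qed.

Lemma enum0 : s 0%N = 0.
Proof.
have [h sh] := value_enum ring1 (valuation1 v_val).
have := enum_le (leq0n h); rewrite sh => le0.
have [x /ring_sub_vball Ux vx] := enum_value 0.
by move: Ux; rewrite (vball_val _ vx) => ge0; apply/eqP; rewrite eq_le le0.
Qed.

Lemma truncE h : T h = R `&` U (s h).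
Proof. by []. Qed.

Lemma trunc0 : T 0%N = R.
Proof. by rewrite truncE enum0; apply: setIidl; apply: ring_sub_vball. Qed.

Lemma trunc_le h k : (h <= k)%N -> T k `<=` T h.
Proof. by move=> hk x [Rx Ux]; split=> //; apply: vball_le Ux; apply: enum_le. Qed.

Lemma trunc_sub_ring h : T h `<=` R.
Proof. by move=> x []. Qed.

Lemma fractional_trunc h : fractional (T h).
Proof. exact: fractionalI fractional_ring (fractional_vball _). Qed.

Lemma truncS h x : R x -> U (s h + 1) x -> T h.+1 x.
Proof.
move=> Rx Ux; split=> //; have [->|x0] := eqVneq x 0; first exact: vball0.
have [i vx] := valuation_fin v_val x0; have [k sk] := value_enum Rx vx.
move: Ux; rewrite (vball_val _ vx) vx lee_fin -sk => lt; apply: enum_le.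
by apply: enum_ltn; lia.
Qed.

Lemma trunc_cancel h x z : v x = (s h)%:E -> R x -> T h z ->
  exists2 a, R a & T h.+1 (z - a * x).
Proof.
move=> vx Rx [Rz Uz]; have [a Ra Ua] := cancel_leading vx Uz.
by exists a => //; apply: truncS Ua; apply: ringB => //; apply: ringM.
Qed.

(** Multiplication by an element x of value s_h maps (T (h+1))* into R : m,
    since m x lies in T (h+1).  If x y lies in R, then y lies in (T h)*, since x
    and T (h+1) generate T h. *)
Lemma type_seq_le h : m `<=` R -> (type_seq R v s h.+1 <= cm_type R m)%N.
Proof.
move=> mR; have [x Rx vx] := enum_value h.
apply: (@length_le_mul x).
- exact/fractional_dual/fractional_trunc.
- exact/fractional_dual/fractional_trunc.
- exact/fractional_dual/fractional_maximal_ideal.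
- exact: fractional_ring.
- exact/dual_anti/trunc_le.
- exact: ring_sub_dual.
- move=> y Py z mz; rewrite mulrAC mulrC; apply: Py; apply: truncS.
    by apply: ringM => //; apply: mR.
  move: mz; rewrite (maximal_idealE mR) => -[_]; apply: vballM => //.
  by rewrite (vball_val _ vx).
- move=> y Py Rxy z Tz; have [a Ra Ta] := trunc_cancel vx Rx Tz.
  have -> : y * z = y * (z - a * x) + a * (x * y) by ring.
  by apply: ringD; [exact: Py|exact: ringM].
Qed.

Lemma length_type_seq p :
  length R (T p)^* R = (\sum_(0 <= h < p) type_seq R v s h.+1)%N.
Proof.
elim: p => [|p ih].
  by rewrite big_nil trunc0 dual_ring length_refl //; apply: fractional_ring.
rewrite big_nat_recr //= -ih addnC; apply: length_add.
- exact/fractional_dual/fractional_trunc.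
- exact/fractional_dual/fractional_trunc.
- exact: fractional_ring.
- exact/dual_anti/trunc_le.
- exact/ring_sub_dual/trunc_sub_ring.
Qed.

(** The factors of the filtration of J* / R by the J* cap (T k)* embed in the
    factors for R itself.  If some x in J has value s_k, then T k is contained in
    R x + T (k+1), so J* cap (T (k+1))* already sends T k into R and the factor
    vanishes. *)
Lemma length_dual_le J p : submodule R J -> T p `<=` J -> J `<=` R ->
  (length R J^* R <=
     \sum_(0 <= h < p | ~~ `[< values v J (s h) >]) type_seq R v s h.+1)%N.
Proof.
move=> sJ TJ JR; have fT h := fractional_dual (fractional_trunc h).
have fJ : fractional J^*.
  by apply/fractional_dual/(fractional_squeeze sJ (fractional_trunc p) fractional_ring).
pose D k := J^* `&` (T k)^*.
have fD k : fractional (D k) by apply: fractionalI.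
have RD k : R `<=` D k.
  by move=> x Rx; split; apply: ring_sub_dual Rx => //; apply: trunc_sub_ring.
have DS k : D k `<=` D k.+1.
  by apply: setIS; apply/dual_anti/trunc_le.
have <- : D p = J^* by apply/setIidl/dual_anti.
elim: p {TJ} => [|k ih].
  rewrite big_nil leqn0; apply/eqP.
  have -> : D 0%N = R by rewrite /D trunc0 dual_ring; apply/setIidr/ring_sub_dual.
  exact/length_refl/fractional_ring.
rewrite big_mkcond big_nat_recr //= -big_mkcond /=.
rewrite (length_add (fD k.+1) (fD k) fractional_ring (DS k) (RD k)) addnC.
apply: leq_add => //.
case: asboolP => [[x [Jx _ vx]]|_] /=.
  suff -> : D k = D k.+1 by rewrite length_refl.
  apply/seteqP; split=> // y [Jy Ty]; split=> // z Tz.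
  have [a Ra Ta] := trunc_cancel vx (JR _ Jx) Tz.
  have -> : y * z = y * (z - a * x) + a * (y * x) by ring.
  apply: ringD; first exact: Ty.
  by apply: ringM => //; apply: Jy.
apply: (@length_le_mul 1) => //.
- exact/dual_anti/trunc_le.
- by move=> y [_ Ty]; rewrite mul1r.
- by move=> y [Jy _]; rewrite mul1r.
Qed.

(** Since J contains T p, the values of R missing from J are among the s_h with
    h < p. *)
Lemma length_ring_count J p : submodule R J -> T p `<=` J -> J `<=` R ->
  length R R J = (\sum_(0 <= h < p) ~~ `[< values v J (s h) >])%N.
Proof.
move=> sJ TJ JR; have [N' fR] := fractional_ring.
have [N'' fJ] := fractional_squeeze sJ (fractional_trunc p) fractional_ring TJ JR.
have {}fR := framed_le (leq_maxl N' N'') fR; have {}fJ := framed_le (leq_maxr N' N'') fJ.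
move: (maxn _ _) fR fJ => N fR fJ.
have := length_count fR fJ JR; rewrite (value_countD N JR) addnC => /addnI ->.
have -> : (\sum_(0 <= h < p) ~~ `[< values v J (s h) >])%N =
          count (fun h => ~~ `[< values v J (s h) >]) (index_iota 0 p).
  by rewrite -sum1_count [RHS]big_mkcond; apply: eq_bigr => h _; case: asboolP.
have s_inj : injective s.
  by move=> i j sij; case: s_enum => s_lt _; case: (ltngtP i j) => // /s_lt; rewrite sij ltxx.
rewrite -!size_filter -(size_map s).
apply/perm_size/uniq_perm.
- exact/filter_uniq/window_uniq.
- by rewrite map_inj_uniq // filter_uniq // iota_uniq.
move=> i; rewrite mem_filter; apply/andP/mapP => [[gi _]|[h]].
  have /andP[/asboolP [x [Rx _ vx]] nJ] := gi.
  have [h sh] := value_enum Rx vx; exists h; last by rewrite sh.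
  rewrite mem_filter sh nJ mem_index_iota /= ltnNge; apply: contra nJ => ph.
  apply/asboolP; apply: (valuesP _ vx); apply/TJ/(trunc_le ph).
  by split=> //; rewrite vx sh.
rewrite mem_filter => /andP[nJ _] ->.
have gi : gap R J (s h).
  by apply/andP; split=> //; apply/asboolP; case: s_enum => _ <-; exists h.
by split=> //; apply: gap_window gi.
Qed.

Lemma length_ring_trunc p : length R R (T p) = p.
Proof.
have sT : submodule R (T p) by apply: submodI; [exact: ring_submodule|exact: submod_vball].
rewrite (length_ring_count sT (@subset_refl _ _) (@trunc_sub_ring p)).
rewrite -[RHS]subn0 -[RHS]muln1 -sum_nat_const_nat; apply: eq_big_nat => h /andP[_ hp].
case: asboolP => // -[x [[_ Ux] _ vx]]; move: Ux; rewrite vx lee_fin leNgt.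
by case: s_enum => s_lt _; rewrite s_lt.
Qed.

(** A module over the valuation ring contains with x the whole ball of radius
    v(x); hence gamma R I is the largest ball inside I.  Its radius is the value
    of a power of t lying in R, that is some s_p. *)
Lemma gamma_trunc I : ideal R I -> I <> [set 0] ->
  exists p, gamma R I = T p /\ gamma R I `<=` I.
Proof.
move=> iI I0; have [sI IsR] := iI.
have [N [_ UI _]] := fractional_ideal iI I0.
have ex : exists n : nat, `[< U n%:Z `<=` I >] by exists N; apply/asboolP.
case: (ex_minnP ex) => n /asboolP nI minn.
have gU : gamma R I = U n%:Z.
  apply/seteqP; split=> [x [L [[L0 LD LM] LI] Lx]|x Ux]; last first.
    exists (U n%:Z) => //; split=> //; rewrite integral_closureE.
    split; [exact: vball0|exact: vballD|] => a y Ua Uy.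
    by rewrite -[n%:Z]add0r; apply: vballM.
  have [->|x0] := eqVneq x 0; first exact: vball0.
  have [i vx] := valuation_fin v_val x0.
  have := ring_sub_vball (IsR _ (LI _ Lx)); rewrite !(vball_val _ vx) => i0.
  have := minn (absz i); rewrite -lez_nat gez0_abs //; apply; apply/asboolP => y Uy.
  apply: LI; rewrite -[y](divfK x0); apply: LM => //.
  by rewrite integral_closureE; have := vball_div v_val vx Uy; rewrite subrr.
have vt := valuation_exp n%:Z.
have Rt : R (t ^ n%:Z) by apply/IsR/nI; rewrite (vball_val _ vt).
have [p sp] := value_enum Rt vt.
exists p; rewrite gU; split=> //; rewrite truncE sp; apply/esym/setIidr.
exact: subset_trans IsR.
Qed.

End Ring.

Theorem corollary3p13 (K : fieldType) (R m : set K) (t : K)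
    (v : K -> \bar int) (s : nat -> int) (I : set K)
    (R_subring : subring_closed [in R])
    (R_frac : has_fraction_field R)
    (R_noeth : noetherian R)
    (R_local : local_ring R m)
    (R_dim1 : krull_dim R 1)
    (k_infinite : infinite_set (cosets R m))
    (Rbar_fin : fin_gen R (integral_closure R))
    (v_val : is_valuation v)
    (Rbar_dvr : integral_closure R = valuation_ring v)
    (v_t : v t = 1%:E)
    (R_resrat : natural_iso R m (integral_closure R)
                  (scale t (integral_closure R)))
    (s_enum : increasing_enumeration s (values v R))
    (I_ideal : ideal R I)
    (I_nonzero : I <> [set 0])
    (I_proper : I <> R) :
  let r := cm_type R m in
  let r_ := type_seq R v s in
  let Idd := dual R (dual R I) in
  let V := V_set R v s I in
  let n_I := length R R (gamma R I) in
  (b_inv R m I >= r%:Z * (length R Idd I)%:Z /\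
   r%:Z * (length R Idd I)%:Z >= 0) /\
  (b_inv R m I = 0 <->
   [/\ I = Idd,
       forall h : nat, (1 <= h)%N -> ~ V h -> r_ h = r &
       (\sum_(1 <= h < n_I.+1 | h \in V) r_ h)%N
         = length R (colon R (gamma R I)) (dual R I)]).
Proof.
move=> r r_ Idd V n_I.
have mR : m `<=` R by case: R_local => -[[]].
have IR : I `<=` R by case: I_ideal.
have [p [gT gI]] : exists p, gamma R I = trunc R v s p /\ gamma R I `<=` I.
  by apply: (@gamma_trunc K R m t v).
have n_Ip : n_I = p by rewrite /n_I gT; apply: (@length_ring_trunc K R m t v).
have IIdd : I `<=` Idd by apply: sub_bidual.
have IddR : Idd `<=` R by apply: bidual_sub_ring.
have TIdd : trunc R v s p `<=` Idd by rewrite -gT; apply: subset_trans IIdd.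
have fR : fractional R v R by apply: (@fractional_ring K R m t v).
have fI : fractional R v I by apply: (@fractional_ideal K R m t v).
have fI' : fractional R v (dual R I) by apply: (@fractional_dual K R m t v).
have fIdd : fractional R v Idd by apply: (@fractional_dual K R m t v).
have fT : fractional R v (trunc R v s p) by apply: (@fractional_trunc K R m t v).
have sIdd : submodule R Idd by case: fIdd => ? [].
have r_gt0 : (0 < r)%N by apply: (@cm_type_gt0 K R m t v).
have r_le h : (r_ h.+1 <= r)%N by apply: (@type_seq_le K R m t v).
have VE h : (h.+1 \in V) = `[< values v Idd (s h) >].
  apply/idP/asboolP; first by rewrite in_setE => -[h' ? [<-]].
  by move=> ?; rewrite in_setE; exists h.
(* The sums run over h + 1, so that s h is the value that decides whether
   h + 1 lies in V. *)
pose W := (\sum_(0 <= h < p | ~~ `[< values v Idd (s h) >]) r_ h.+1)%N.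
pose S := (\sum_(0 <= h < p | `[< values v Idd (s h) >]) r_ h.+1)%N.
have SE : (\sum_(1 <= h < n_I.+1 | h \in V) r_ h)%N = S.
  by rewrite n_Ip big_add1 /=; apply: eq_bigl => h; rewrite VE.
have L_add : length R R I = (length R R Idd + length R Idd I)%N.
  by apply: (@length_add K R m t v).
have IddE : length R R Idd = (\sum_(0 <= h < p) ~~ `[< values v Idd (s h) >])%N.
  by apply: (@length_ring_count K R m t v).
have W_leif : (W <= r * length R R Idd ?= iff
    [forall h : 'I_p, `[< values v Idd (s h) >] || (r_ h.+1 == r)])%N.
  rewrite IddE big_distrr /= /W big_mkcond !big_mkord; apply: leqif_sum => h _.
  by case: asboolP => _; rewrite ?muln0 ?muln1 /=; [exact: leqif_refl|split].
have W_le : (W <= r * length R R Idd)%N by case: W_leif.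
have I'_le : (length R (dual R I) R <= W)%N.
  by rewrite -[dual R I]tridual; apply: (@length_dual_le K R m t v).
have gamma_add : (length R (colon R (gamma R I)) (dual R I) + length R (dual R I) R = S + W)%N.
  have -> : (S + W = \sum_(0 <= h < p) r_ h.+1)%N
    by rewrite (bigID (fun h => `[< values v Idd (s h) >])).
  rewrite -(@length_type_seq _ R m t v) // gT; apply/esym/(@length_add K R m t v) => //.
  - by apply: (@fractional_dual K R m t v).
  - by apply: dual_anti; rewrite -gT.
  - exact: ring_sub_dual.
have W_eq : W = (r * length R R Idd)%N <->
            forall h, (1 <= h)%N -> ~ V h -> r_ h = r.
  have [_ W_iff] := W_leif; split=> [/eqP|r_eq].
    rewrite W_iff => /forallP r_eq [//|h] _ nVh.
    have ndd : ~~ `[< values v Idd (s h) >] by rewrite -VE; apply/negP; rewrite in_setE.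
    (* For h >= p the value s_h is attained in trunc p, so h + 1 lies in V. *)
    have [ph|hp] := leqP p h; last first.
      by have := r_eq (Ordinal hp); rewrite /= (negPf ndd) => /eqP.
    case: nVh; rewrite -in_setE VE; apply/asboolP.
    have [x Rx vx] := enum_value s_enum h.
    apply: (valuesP v_val _ vx); apply/TIdd/(trunc_le s_enum ph).
    by split=> //; rewrite vx.
  apply/eqP; rewrite W_iff; apply/forallP => h; rewrite -VE.
  have [//|/negP] := boolP (h.+1 \in V); rewrite in_setE => nVh /=.
  by apply/eqP/r_eq.
(* From here on only arithmetic with l(I*/R) <= W <= r l(R/I** ) remains. *)
rewrite /b_inv -/r -/Idd L_add SE; split; first split.
- nia.
- nia.
split=> [b0|[IE /W_eq WE SE']].
  have q0 : length R Idd I = 0%N by nia.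
  split; last by nia.
  - by apply/esym; apply: (@length_eq0 K R m t v) q0.
  - by apply/W_eq; nia.
have q0 : length R Idd I = 0%N by rewrite -IE; apply: (@length_refl K R m t v).
nia.
Qed.
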